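(* Let $N$ be a positive integer, and let $t_1, \ldots, t_k$ be a $k$-tuple of complex numbers in the unit disc $\mathbb{D} = \{z \in \mathbb{C} : |z| < 1\}$. Put $m = (N+1)^k$. Then there exist $m$ points $w^i = (w^i_1, \ldots, w^i_k)$, $i = 1, \ldots, m$, on the $k$-torus $\mathbb{T}^k$, and $m$ nonnegative numbers $a_1, \ldots, a_m$ satisfying $\sum_{i=1}^m a_i = 1$, such that for every polynomial $p(z_1, \ldots, z_k)$ of degree less than or equal to $N$, $$p(t_1, \ldots, t_k) = \sum_{i=1}^{m} a_i\, p(w^i_1, \ldots, w^i_k).$$
   Context: $\mathbb{T} = \{z \in \mathbb{C} : |z| = 1\}$. Polynomials have complex coefficients, and degree means total degree. *)

(* Defs.v *)
From mathcomp Require Export all_boot all_order all_algebra.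
From mathcomp Require Export reals complex mpoly.

(* Main.v *)
Require Import Defs.
From mathcomp Require Import separable ring.

(* For one variable, the zeros of
   [q z = z ^+ N * (z - t) - (1 - t^* z)] are [N.+1] distinct points of the
   unit circle, so Lagrange interpolation at them gives an exact formula for
   [f.[t]] when [deg f <= N], with weights [q.[t] / ((t - w) q'(w))].  These are
   nonnegative since [q.[t] = `|t| ^+ 2 - 1] and
   [(w - t) q'(w) = N `|w - t| ^+ 2 + 1 - `|t| ^+ 2] at every zero [w].  The
   product of the [k] one-variable rules then integrates every monomial whose
   degree in each variable is at most [N]. *)

Set Implicit Arguments.
Unset Strict Implicit.
Unset Printing Implicit Defensive.

Import Order.TTheory GRing.Theory Num.Theory.
Local Open Scope ring_scope.
Local Open Scope complex_scope.

(** The interpolant [g], built from the cofactors [Q x] of ['X - x%:P] in [q], agrees with [f] on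
    [s]; a nonzero [f - g] would have more roots than its size allows. *)
Lemma lagrange_interpolation (F : fieldType) (s : seq F) (f : {poly F}) (t : F) :
  let q := \prod_(y <- s) ('X - y%:P) in
  uniq s -> t \notin s -> (size f <= size s)%N ->
  f.[t] = \sum_(x <- s) q.[t] / ((t - x) * q^`().[x]) * f.[x].
Proof.
move=> q s_uniq t_notin sz_f.
pose Q x : {poly F} := \prod_(y <- rem x s) ('X - y%:P).
have qE x : x \in s -> q = ('X - x%:P) * Q x.
  by move=> xs; rewrite /q (perm_big _ (perm_to_rem xs)) big_cons.
have rootQ x y : x \in s -> y \in s -> x != y -> (Q x).[y] = 0.
  move=> xs ys neq_xy; apply/rootP; rewrite root_prod_XsubC.
  by rewrite (rem_filter _ s_uniq) mem_filter /= eq_sym neq_xy.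
have derqE x : x \in s -> q^`().[x] = (Q x).[x].
  move=> xs; rewrite {1}(qE _ xs) derivM derivXsubC mul1r !hornerE subrr.
  by rewrite mul0r addr0.
have Qx_neq0 x : x \in s -> (Q x).[x] != 0.
  move=> xs; have : ~~ root (Q x) x.
    by rewrite root_prod_XsubC (rem_filter _ s_uniq) mem_filter /= eqxx.
  by rewrite rootE.
pose g := \sum_(x <- s) (f.[x] / (Q x).[x]) *: Q x.
have fg : f = g.
  apply/eqP; rewrite -subr_eq0; apply: contraT => nz_fg.
  have roots_fg : all (root (f - g)) s.
    apply/allP => x xs; rewrite rootE hornerD hornerN horner_sum.
    rewrite /g (big_rem x xs) /= big_seq big1; last first.
      move=> y; rewrite (rem_filter _ s_uniq) mem_filter /= => /andP[neq_yx ys].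
      by rewrite hornerZ (rootQ _ _ ys xs neq_yx) mulr0.
    by rewrite hornerZ divfK ?Qx_neq0 // addr0 subrr.
  have := max_poly_roots nz_fg roots_fg s_uniq; rewrite ltnNge => /negP[].
  rewrite (leq_trans (size_polyD _ _)) // geq_max sz_f size_polyN.
  rewrite (leq_trans (size_sum _ _ _)) //; apply/bigmax_leqP_seq => x xs _.
  rewrite (leq_trans (size_scale_leq _ _)) // size_prod_XsubC size_rem //.
  by rewrite prednK //; case: (s) xs.
rewrite [in LHS]fg horner_sum big_seq [RHS]big_seq; apply: eq_bigr => x xs.
have t_x : t - x != 0 by rewrite subr_eq0; apply: contraNneq t_notin => ->.
rewrite derqE // (qE _ xs) !hornerE; have := Qx_neq0 _ xs.
by move: (Q x).[x] (Q x).[t] => u v u0; field; apply/andP.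
Qed.

Section DiscQuadrature.
Variables (C : numClosedFieldType) (N : nat) (t : C).
Hypotheses (N_gt0 : (0 < N)%N) (t_lt1 : `|t| < 1).

(* The zeros of [paraorth] are the solutions of
   [z ^+ N * ((z - t) / (1 - t^* z)) = 1], a Blaschke product of degree [N.+1]. *)
Definition paraorth : {poly C} := 'X^N * ('X - t%:P) - (1 - t^* *: 'X).

Lemma horner_paraorth z : paraorth.[z] = z ^+ N * (z - t) - (1 - t^* * z).
Proof. by rewrite /paraorth !hornerE. Qed.

Lemma size_paraorth : size paraorth = N.+2 /\ paraorth \is monic.
Proof.
have sz1 : size ('X^N * ('X - t%:P) : {poly C}) = N.+2.
  by rewrite mulrC size_mulXn ?polyXsubC_eq0 // size_XsubC addn2.
(* The subtracted term may have size 2, so [N_gt0] is what keeps the leading term intact. *)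
have sz2 : (size (1 - t^* *: 'X : {poly C})%R < N.+2)%N.
  rewrite ltnS (leq_trans (size_polyD _ _)) // geq_max size_poly1 /=.
  by rewrite size_polyN (leq_trans (size_scale_leq _ _)) ?size_polyX.
rewrite /paraorth; split; first by rewrite size_polyDl ?size_polyN sz1.
rewrite monicE lead_coefDl ?size_polyN ?sz1 // lead_coef_Mmonic ?monicXsubC //.
by rewrite lead_coefXn.
Qed.

(** At a root, |z|^N |z - t| = |1 - t^* z|. By [key], |z - t| is the smaller of the two moduli
    inside the disc and the larger outside, and the factor |z|^N only widens the gap. *)
Lemma norm_root_paraorth z : root paraorth z -> `|z| = 1.
Proof.
rewrite rootE horner_paraorth subr_eq0 => /eqP/(congr1 Num.norm).
rewrite normrM normrX => E.
have key : `|1 - t^* * z| ^+ 2 - `|z - t| ^+ 2 = (1 - `|t| ^+ 2) * (1 - `|z| ^+ 2).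
  by rewrite !normCK !rmorphB /= !rmorphM /= conjCK rmorph1; ring.
have t2 : 0 < 1 - `|t| ^+ 2 by rewrite subr_gt0 exprn_ilt1.
case: (real_ltgtP (normr_real z) (real1 C)) => // z1.
  have : `|z - t| < `|1 - t^* * z|.
    rewrite -(ltr_pXn2r (n := 2)) ?nnegrE // -subr_gt0 key mulr_gt0 //.
    by rewrite subr_gt0 exprn_ilt1.
  by rewrite -E le_gtF // ler_piMl // exprn_ile1 // ltW.
have : `|1 - t^* * z| < `|z - t|.
  rewrite -(ltr_pXn2r (n := 2)) ?nnegrE // -subr_lt0 key pmulr_rlt0 //.
  by rewrite subr_lt0 exprn_egt1 // -lt0n.
by rewrite -E le_gtF // ler_peMl // exprn_ege1 // ltW.
Qed.

Lemma deriv_paraorth z : root paraorth z ->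
  (z - t) * paraorth^`().[z] = `|z - t| ^+ 2 *+ N + (1 - `|t| ^+ 2).
Proof.
move=> z_root; have z1 := norm_root_paraorth z_root.
have zz : z * z^* = 1 by rewrite -normCK z1 expr1n.
move: z_root; rewrite rootE horner_paraorth subr_eq0 => /eqP E.
rewrite /paraorth derivB derivM derivXsubC derivXn derivB derivZ derivX derivC.
rewrite !hornerE hornerMn hornerXn !normCK rmorphB /=.
have zN : z ^+ N = z * z ^+ N.-1 by rewrite -exprS prednK.
(* On the circle [z^*] inverts [z]: multiplying the root equation by it lowers the exponent and
   turns the derivative of the power into the conjugate of [z - t]. *)
have E' : z ^+ N.-1 * (z - t) = z^* - t^*.
  have : z^* * (z ^+ N * (z - t)) = z^* * (1 - t^* * z) by rewrite E.
  rewrite zN => H.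
  transitivity ((z * z^*) * (z ^+ N.-1 * (z - t))); first by rewrite zz mul1r.
  transitivity (z^* * (z * z ^+ N.-1 * (z - t))); first by ring.
  rewrite H; transitivity (z^* - t^* * (z * z^*)); first by ring.
  by rewrite zz mulr1.
transitivity (((z - t) * (z ^+ N.-1 * (z - t))) *+ N
              + (z ^+ N * (z - t) + t^* * (z - t))).
  by rewrite -mulr_natr -[in RHS]mulr_natr; ring.
by rewrite E' E -addrA; congr (_ + _); ring.
Qed.

(** Used twice: it makes the zeros simple, hence the nodes distinct, and it gives the weights their
    sign. *)
Lemma deriv_paraorth_gt0 z : root paraorth z ->
  0 < (z - t) * paraorth^`().[z].
Proof.
move=> z_root; rewrite deriv_paraorth // ltr_wpDl ?mulrn_wge0 ?exprn_ge0 //.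
by rewrite subr_gt0 exprn_ilt1.
Qed.

Lemma disc_quadrature : exists (w : 'I_N.+1 -> C) (a : 'I_N.+1 -> C),
  [/\ forall i, `|w i| = 1, forall i, 0 <= a i
    & forall f : {poly C}, (size f <= N.+1)%N -> f.[t] = \sum_i a i * f.[w i]].
Proof.
have [size_q monic_q] := size_paraorth.
have [s] := closed_field_poly_normal paraorth.
rewrite (monicP monic_q) scale1r => qE.
have size_s : size s = N.+1.
  by apply/eqP; rewrite -eqSS -size_q qE size_prod_XsubC.
have mem_sE z : z \in s = root paraorth z by rewrite qE root_prod_XsubC.
have uniq_s : uniq s.
  rewrite -separable_prod_XsubC -qE unlock.
  apply/Pdiv.ClosedField.coprimepP => z /deriv_paraorth_gt0.
  by apply: contraTneq => ->; rewrite mulr0 ltxx.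
have t_notin : t \notin s.
  by rewrite mem_sE; apply/negP => /norm_root_paraorth t1; move: t_lt1; rewrite t1 ltxx.
pose w (i : 'I_N.+1) := s`_i.
have ws i : w i \in s by rewrite mem_nth ?size_s.
exists w, (fun i => (1 - `|t| ^+ 2) / ((w i - t) * paraorth^`().[w i])).
split=> [i|i|f sz_f]; first by rewrite norm_root_paraorth // -mem_sE.
  rewrite divr_ge0 ?subr_ge0 ?exprn_ile1 // 1?ltW //.
  by rewrite deriv_paraorth_gt0 // -mem_sE.
rewrite (lagrange_interpolation uniq_s t_notin) ?size_s // -qE.
rewrite (big_nth 0) size_s big_mkord; apply: eq_bigr => i _; congr (_ * _).
rewrite horner_paraorth subrr mulr0 sub0r normCK.
by rewrite -(opprB (w i) t) (mulNr (w i - t)) invrN mulrNN (mulrC t).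
Qed.

End DiscQuadrature.

Lemma leq_mnm_mdeg (n : nat) (m : 'X_{1.. n}) (i : 'I_n) : (m i <= mdeg m)%N.
Proof. by rewrite mdegE (bigD1 i) //= leq_addr. Qed.

Theorem corollary4p8 (R : realType) (N k : nat) (hN : (0 < N)%N)
    (t : 'I_k -> R[i]) (ht : forall j : 'I_k, `|t j| < 1) :
  exists (w : 'I_((N + 1) ^ k) -> 'I_k -> R[i]) (a : 'I_((N + 1) ^ k) -> R),
    [/\ forall (i : 'I_((N + 1) ^ k)) (j : 'I_k), `|w i j| = 1,
        forall i : 'I_((N + 1) ^ k), 0 <= a i,
        \sum_(i < (N + 1) ^ k) a i = 1
      & forall p : {mpoly R[i][k]}, (msize p <= N.+1)%N ->
          p.@[t] = \sum_(i < (N + 1) ^ k) (a i)%:C * p.@[w i]].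
Proof.
have quad j := disc_quadrature hN (ht j).
have [w1 /fin_all_exists[a1 H]] := fin_all_exists quad.
(* A point of the product grid is a choice of one node per coordinate; [node] enumerates these
   choices. *)
have card_nodes : ((N + 1) ^ k = #|{: {ffun 'I_k -> 'I_N.+1}}|)%N.
  by rewrite card_ffun !card_ord addn1.
pose node i := enum_val (cast_ord card_nodes i).
have node_bij : bijective node.
  exists (fun f => cast_ord (esym card_nodes) (enum_rank f)) => x.
    by rewrite /node enum_valK cast_ordK.
  by rewrite /node cast_ordKV enum_rankK.
pose w (f : {ffun 'I_k -> 'I_N.+1}) j := w1 j (f j).
pose a (f : {ffun 'I_k -> 'I_N.+1}) := \prod_j a1 j (f j).
have a_ge0 f : 0 <= a f.
  by apply: prodr_ge0 => j _; case: (H j) => _ ->.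
(* The one-variable weights live in [R[i]]; being nonnegative there, their products are real, so
   taking [Re] loses nothing. *)
have aE f : (complex.Re (a f))%:C = a f by rewrite RRe_real // ger0_real.
have quad_a (p : {mpoly R[i][k]}) : (msize p <= N.+1)%N ->
    p.@[t] = \sum_f a f * p.@[w f].
  move=> sz_p; rewrite mevalE; under [RHS]eq_bigr do rewrite mevalE mulr_sumr.
  rewrite exchange_big /= big_seq [RHS]big_seq; apply: eq_bigr => m m_p.
  under [RHS]eq_bigr do rewrite mulrCA -big_split.
  rewrite -mulr_sumr; congr (_ * _).
  (* On a monomial the sum over the grid factors into one-variable sums, each exact since
     [m j <= mdeg m <= N]. *)
  rewrite -(bigA_distr_bigA (fun j i => a1 j i * w1 j i ^+ m j)).
  apply: eq_bigr => j _; have [_ _ /(_ 'X^(m j))] := H j.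
  rewrite size_polyXn ltnS hornerXn => ->; last first.
    rewrite (leq_trans (leq_mnm_mdeg _ _)) // -ltnS.
    exact: leq_trans (msize_mdeg_lt m_p) sz_p.
  by apply: eq_bigr => i _; rewrite hornerXn.
exists (fun i => w (node i)), (fun i => complex.Re (a (node i))).
split=> [i j|i||p sz_p].
- by case: (H j) => ->.
- by rewrite -lecR aE.
(* The total weight is the quadrature of the constant polynomial 1. *)
- apply: (fmorph_inj (real_complex R)).
  rewrite rmorph_sum rmorph1 /= -(mpoly.mevalC t 1) quad_a ?msizeC ?oner_eq0 //.
  rewrite (reindex node) /=; last exact: onW_bij.
  by apply: eq_bigr => i _; rewrite aE mevalC mulr1.
rewrite quad_a // (reindex node) /=; last exact: onW_bij.
by apply: eq_bigr => i _; rewrite aE.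
Qed.
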